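(* Let $\mathcal{X}=\{\boldsymbol{x}_1,\dots,\boldsymbol{x}_m\}\subset\mathbb{R}^n$ be a poised set, also poised in the linear interpolation or regression sense, with $n+1\le|\mathcal{X}|=m<\frac12(n+1)(n+2)$, contained in the $\ell_2$ ball $\mathcal{B}_\Delta(\boldsymbol{x}_c)$ of radius $\Delta>0$ centered at a point $\boldsymbol{x}_c\in\mathcal{X}$. Let $Q_\alpha$ be a quadratic function, let $f:\mathbb{R}^n\to\mathbb{R}$ be differentiable, and assume that $Q_\beta:=\mathcal{M}^{\mathcal{X}}_{Q_\alpha}(f)$ is a fully linear model of $f$ with constants $\kappa_g,\kappa_f$, i.e. $$\|\nabla Q_\beta(\boldsymbol{x})-\nabla f(\boldsymbol{x})\|_2\le\kappa_g\Delta,\qquad |Q_\beta(\boldsymbol{x})-f(\boldsymbol{x})|\le\kappa_f\Delta^2,\qquad\forall\,\boldsymbol{x}\in\mathcal{B}_\Delta(\boldsymbol{x}_c).$$ Let $C_1,C_2\in\mathbb{R}$, $\hat Q_\beta:=\mathcal{M}^{\mathcal{X}}_{Q_\alpha}(C_1f+C_2)$, $\tilde Q:=\mathcal{M}^{\mathcal{X}}_0(Q_\alpha)$, and let $\mu_\alpha$ be the Lipschitz constant of $\nabla Q_\alpha$. Then $\hat Q_\beta$ is a fully linear model of $C_1f+C_2$, i.e. for all $\boldsymbol{x}\in\mathcal{B}_\Delta(\boldsymbol{x}_c)$, $$\|\nabla\hat Q_\beta(\boldsymbol{x})-\nabla(C_1f(\boldsymbol{x})+C_2)\|_2\le\hat\kappa_g\Delta,\qquad|\hat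 Q_\beta(\boldsymbol{x})-(C_1f(\boldsymbol{x})+C_2)|\le\hat\kappa_f\Delta^2,$$ with constants $$\hat\kappa_g=|C_1|\kappa_g+|C_1-1|\left(\frac{5\sqrt{m-1}}{2}\big\|\hat{\boldsymbol{L}}^\dagger\big\|_2\big(\mu_\alpha+\|\nabla^2\tilde Q\|_2\big)\right),$$ $$\hat\kappa_f=|C_1|\kappa_f+|C_1-1|\left(\frac{5\sqrt{m-1}}{2}\big\|\hat{\boldsymbol{L}}^\dagger\big\|_2+\frac12\right)\big(\mu_\alpha+\|\nabla^2\tilde Q\|_2\big).$$
   Context: A quadratic function on $\mathbb{R}^n$ is a polynomial of degree at most $2$. A set $\mathcal{X}=\{\boldsymbol{x}_1,\dots,\boldsymbol{x}_m\}\subset\mathbb{R}^n$ is poised if its KKT matrix $\boldsymbol{W}=\begin{pmatrix}\boldsymbol{A}&\boldsymbol{X}^\top\\ \boldsymbol{X}&\boldsymbol{0}\end{pmatrix}$ is invertible, where, for a base point $\boldsymbol{x}_0\in\mathbb{R}^n$, $\boldsymbol{A}_{ij}=\frac12\big((\boldsymbol{x}_i-\boldsymbol{x}_0)^\top(\boldsymbol{x}_j-\boldsymbol{x}_0)\big)^2$ for $1\le i,j\le m$ and $\boldsymbol{X}\in\mathbb{R}^{(n+1)\times m}$ has $j$-th column $(1,(\boldsymbol{x}_j-\boldsymbol{x}_0)^\top)^\top$. For a poised $\mathcal{X}$ with $n+1\le|\mathcal{X}|<\frac12(n+1)(n+2)$, a quadratic function $Q_\alpha$ and $h:\mathbb{R}^n\to\mathbb{R}$,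 $\mathcal{M}^{\mathcal{X}}_{Q_\alpha}(h)$ is the (unique) solution of: minimize $\|\nabla^2Q-\nabla^2Q_\alpha\|_F^2$ over quadratic functions $Q$ subject to $Q(\boldsymbol{x})=h(\boldsymbol{x})$ for all $\boldsymbol{x}\in\mathcal{X}$; the subscript $0$ means $Q_\alpha=0$. Let $c\in\{1,\dots,m\}$ be the index of the center point $\boldsymbol{x}_c$, and $\hat{\boldsymbol{L}}=\frac1\Delta(\boldsymbol{x}_1-\boldsymbol{x}_c,\dots,\boldsymbol{x}_{c-1}-\boldsymbol{x}_c,\boldsymbol{x}_{c+1}-\boldsymbol{x}_c,\dots,\boldsymbol{x}_m-\boldsymbol{x}_c)^\top\in\mathbb{R}^{(m-1)\times n}$. Poisedness in the linear interpolation or regression sense means that $\hat{\boldsymbol{L}}$ has full column rank $n$; then $\hat{\boldsymbol{L}}^\dagger=(\hat{\boldsymbol{L}}^\top\hat{\boldsymbol{L}})^{-1}\hat{\boldsymbol{L}}^\top$. For matrices, $\|\cdot\|_2$ is the spectral norm. *)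

(* Defs.v *)
From HB Require Import structures.
From mathcomp Require Import all_boot all_order all_algebra.
From mathcomp Require Import all_classical all_reals all_analysis.

Set Implicit Arguments.
Unset Strict Implicit.
Unset Printing Implicit Defensive.
Import Order.TTheory GRing.Theory Num.Theory.
Import numFieldNormedType.Exports.
Local Open Scope classical_set_scope.
Local Open Scope ring_scope.

(* The library norm on matrices is the max-entry norm, hence the explicit
   Euclidean, Frobenius and spectral norms below.  Differentiability does not
   depend on this choice, so the library's [differentiable] is used as is. *)

Section Norms.
Variable R : realType.

Definition dotv n (u v : 'cV[R]_n) : R := \sum_i u i 0 * v i 0.

Definition l2norm n (v : 'cV[R]_n) : R := Num.sqrt (\sum_i v i 0 ^+ 2).

Definition frobenius_norm m n (A : 'M[R]_(m, n)) : R :=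
  Num.sqrt (\sum_i \sum_j A i j ^+ 2).

Definition spectral_norm m n (A : 'M[R]_(m, n)) : R :=
  sup [set l2norm (A *m v) | v in [set v | l2norm v <= 1]].

Definition l2ball n (c : 'cV[R]_n) (r : R) : set 'cV[R]_n :=
  [set x | l2norm (x - c) <= r].

(* Best (least) Lipschitz constant in the Euclidean norms. *)
Definition lipschitz_constant m n (g : 'cV[R]_n -> 'cV[R]_m) : R :=
  inf [set L | 0 <= L /\ forall x y, l2norm (g x - g y) <= L * l2norm (x - y)].

End Norms.

Section Derivatives.
Variables (R : realType) (n : nat).
Implicit Types (f : 'cV[R]_n -> R) (x : 'cV[R]_n).

Definition gradient f x : 'cV[R]_n := \col_i 'D_(delta_mx i 0) f x.

Definition hessian f x : 'M[R]_n :=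
  \matrix_(i, j) 'D_(delta_mx i 0) ('D_(delta_mx j 0) f) x.

(* Polynomial functions of degree at most 2, with arbitrary coefficients;
   H need not be symmetric. *)
Definition quadratic f : Prop :=
  exists (a : R) (b : 'cV[R]_n) (H : 'M[R]_n), forall x,
    f x = a + \sum_i b i 0 * x i 0 + \sum_i \sum_j H i j * (x i 0 * x j 0).

End Derivatives.

Section HessianQuadratic.
Variables (R : realType) (n : nat).

Fact is_derive_coord (i : 'I_n) (x v : 'cV[R]_n) :
  is_derive x v (fun y : 'cV[R]_n => y i 0) (v i 0).
Proof.
have dx : differentiable (fun y : 'cV[R]_n => y i 0) x.
  exact: differentiable_coord.
apply: DeriveDef; first exact: diff_derivable.
have lin : linear (fun y : 'cV[R]_n => y i 0 : R) by move=> k u w; rewrite !mxE.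
pose L := GRing.isLinear.Build _ _ _ _ (fun y : 'cV[R]_n => y i 0 : R) lin.
pose g : {linear 'cV[R]_n -> R} := HB.pack (fun y : 'cV[R]_n => y i 0 : R) L.
rewrite deriveE // (_ : (fun y : 'cV[R]_n => y i 0) = g) //.
rewrite diff_lin //; exact: coord_continuous.
Qed.

Fact is_derive_quadratic (a : R) (b : 'cV[R]_n) (H : 'M[R]_n)
    (f : 'cV[R]_n -> R) x v :
  (forall y, f y = a + \sum_i b i 0 * y i 0
                 + \sum_i \sum_j H i j * (y i 0 * y j 0)) ->
  is_derive x v f (\sum_i b i 0 * v i 0
                 + \sum_i \sum_j H i j * (x i 0 * v j 0 + x j 0 * v i 0)).
Proof.
move=> fE; pose X i (y : 'cV[R]_n) : R := y i 0.
have -> : f = cst a + \sum_i (b i 0 \*: X i)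
    + \sum_i \sum_j (H i j \*: (X i * X j)).
  apply/funext => y; rewrite fE /= !fctE.
  rewrite !fct_sumE; congr (_ + _); apply: eq_bigr => i _.
  by rewrite fct_sumE.
have dX i : is_derive x v (X i) (v i 0) by exact: is_derive_coord.
by apply: is_derive_eq; rewrite add0r.
Qed.

Lemma hessian_quadraticE (a : R) (b : 'cV[R]_n) (H : 'M[R]_n)
    (f : 'cV[R]_n -> R) x :
  (forall y, f y = a + \sum_i b i 0 * y i 0
                 + \sum_i \sum_j H i j * (y i 0 * y j 0)) ->
  hessian f x = H + H^T.
Proof.
move=> fE; apply/matrixP => k l; rewrite !mxE.
have -> : 'D_(delta_mx l 0) f = fun y : 'cV[R]_n =>
    b l 0 + \sum_i (H i l + H l i) * y i 0
  + \sum_i \sum_j (0 : 'M[R]_n) i j * (y i 0 * y j 0).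
  apply/funext => y.
  have [_ ->] := is_derive_quadratic y (delta_mx l 0) fE.
  rewrite [X in _ = _ + X]big1 ?addr0; last first.
    by move=> i _; rewrite big1 // => j _; rewrite mxE mul0r.
  congr (_ + _).
    rewrite (bigD1 l) //= big1 ?addr0 ?mxE ?eqxx ?mulr1 // => i il.
    by rewrite mxE (negbTE il) mulr0.
  under eq_bigr do under eq_bigr do rewrite mulrDr.
  under eq_bigr do rewrite big_split /=.
  rewrite big_split /= [X in _ + X]exchange_big /= -big_split /=.
  apply: eq_bigr => i _; rewrite mulrDl; congr (_ + _).
    rewrite (bigD1 l) //= big1 ?addr0 ?mxE ?eqxx ?mulr1 // => j jl.
    by rewrite mxE (negbTE jl) !mulr0.
  rewrite (bigD1 l) //= big1 ?addr0 ?mxE ?eqxx ?mulr1 // => j jl.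
  by rewrite mxE (negbTE jl) !mulr0.
pose c : 'cV[R]_n := \col_i (H i l + H l i).
have gE (y : 'cV[R]_n) : b l 0 + \sum_i (H i l + H l i) * y i 0
  + \sum_i \sum_j (0 : 'M[R]_n) i j * (y i 0 * y j 0)
  = b l 0 + \sum_i c i 0 * y i 0
  + \sum_i \sum_j (0 : 'M[R]_n) i j * (y i 0 * y j 0).
  by congr (_ + _ + _); apply: eq_bigr => i _; rewrite mxE.
have [_ ->] := is_derive_quadratic x (delta_mx k 0) gE.
rewrite [X in _ + X]big1 ?addr0; last first.
  by move=> i _; rewrite big1 // => j _; rewrite mxE mul0r.
rewrite (bigD1 k) //= big1 ?addr0 ?mxE ?eqxx ?mulr1 // => i ik.
by rewrite !mxE (negbTE ik) mulr0.
Qed.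

Lemma hessian_quadratic (f : 'cV[R]_n -> R) x :
  quadratic f -> hessian f x = hessian f 0.
Proof. by move=> [a [b [H fE]]]; rewrite !(hessian_quadraticE _ fE). Qed.

End HessianQuadratic.

Section Interpolation.
Variables (R : realType) (n m : nat).
Implicit Types (x : 'I_m -> 'cV[R]_n).

Definition kkt_A x (x0 : 'cV[R]_n) : 'M[R]_m :=
  \matrix_(i, j) (2^-1 * dotv (x i - x0) (x j - x0) ^+ 2).

Definition kkt_X x (x0 : 'cV[R]_n) : 'M[R]_(1 + n, m) :=
  col_mx (const_mx 1) (\matrix_(k, j) (x j - x0) k 0).

Definition kkt_matrix x (x0 : 'cV[R]_n) : 'M[R]_(m + (1 + n)) :=
  block_mx (kkt_A x x0) (kkt_X x x0)^T (kkt_X x x0) 0.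

Definition poised x (x0 : 'cV[R]_n) : Prop := kkt_matrix x x0 \in unitmx.

Definition interpolates x (h Q : 'cV[R]_n -> R) : Prop :=
  forall i, Q (x i) = h (x i).

(* Hessians are evaluated at 0 because they are constant for quadratic
   functions, see [hessian_quadratic]. *)
Definition hessian_change (Qa Q : 'cV[R]_n -> R) : R :=
  frobenius_norm (hessian Q 0 - hessian Qa 0) ^+ 2.

Definition least_change_solution x (Qa h Q : 'cV[R]_n -> R) : Prop :=
  [/\ quadratic Q, interpolates x h Q &
      forall P, quadratic P -> interpolates x h P ->
        hessian_change Qa Q <= hessian_change Qa P].

(* The solution exists and is unique when x is poised; the default value 0 is
   irrelevant in that case. *)
Definition least_change_model x (Qa h : 'cV[R]_n -> R) : 'cV[R]_n -> R :=
  xget (cst 0) [set Q | least_change_solution x Qa h Q].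

(* [lift c] enumerates the indices other than c in increasing order. *)
Definition scaled_displacements x (c : 'I_m) (Delta : R) : 'M[R]_(m.-1, n) :=
  Delta^-1 *: \matrix_(i, j) (x (lift c i) - x c) j 0.

End Interpolation.

Definition left_pinv (R : realType) m n (L : 'M[R]_(m, n)) : 'M[R]_(n, m) :=
  invmx (L^T *m L) *m L^T.

Definition fully_linear (R : realType) n (c : 'cV[R]_n) (Delta : R)
    (f Q : 'cV[R]_n -> R) (kg kf : R) : Prop :=
  forall x, l2ball c Delta x ->
    l2norm (gradient Q x - gradient f x) <= kg * Delta /\
    `|Q x - f x| <= kf * Delta ^+ 2.

(* Main.v *)
(* Optimality of a least-change interpolant Q of h means that Q - Qalpha has a
   Hessian orthogonal (for the Frobenius product) to the Hessians of all
   quadratics vanishing on X; the inverse of the KKT matrix supplies such a Q,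
   and it is the only minimizer.  The condition is affine in (Q, h), so, writing
   E := Qalpha - Qtilde, the model of C1 f + C2 is C1 Qbeta + C2 + (1 - C1) E.
   The extra error (1 - C1) E is small because E vanishes on X and its Hessian
   has spectral norm at most nu: Taylor expansions of E at y bound
   dotv (gradient E y) (x i - x c), hence L (gradient E y), and the left inverse
   of L recovers gradient E y. *)
Require Import Defs.
From mathcomp Require Import all_boot all_order all_algebra.
From mathcomp Require Import all_classical all_reals all_analysis.
From mathcomp Require Import ring lra.

Set Implicit Arguments.
Unset Strict Implicit.
Unset Printing Implicit Defensive.
Import Order.TTheory GRing.Theory Num.Theory.
Import numFieldNormedType.Exports.
Local Open Scope classical_set_scope.
Local Open Scope ring_scope.

(** * Euclidean, Frobenius and spectral norms, Lipschitz constants and left inverses *)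

Section EuclideanNorm.
Variable R : realType.

Lemma dotvC n (u v : 'cV[R]_n) : dotv u v = dotv v u.
Proof. by apply: eq_bigr => i _; rewrite mulrC. Qed.

Lemma dotvDl n (u v w : 'cV[R]_n) : dotv (u + v) w = dotv u w + dotv v w.
Proof.
by rewrite /dotv -big_split; apply: eq_bigr => i _; rewrite mxE mulrDl.
Qed.

Lemma dotvZl n (k : R) (u v : 'cV[R]_n) : dotv (k *: u) v = k * dotv u v.
Proof.
by rewrite /dotv mulr_sumr; apply: eq_bigr => i _; rewrite mxE mulrA.
Qed.

Lemma dotvNl n (u v : 'cV[R]_n) : dotv (- u) v = - dotv u v.
Proof. by rewrite -scaleN1r dotvZl mulN1r. Qed.

Lemma dotvBl n (u v w : 'cV[R]_n) : dotv (u - v) w = dotv u w - dotv v w.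
Proof. by rewrite dotvDl dotvNl. Qed.

Lemma dotvDr n (u v w : 'cV[R]_n) : dotv u (v + w) = dotv u v + dotv u w.
Proof. by rewrite !(dotvC u) dotvDl. Qed.

Lemma dotvZr n (k : R) (u v : 'cV[R]_n) : dotv u (k *: v) = k * dotv u v.
Proof. by rewrite !(dotvC u) dotvZl. Qed.

Lemma dotvNr n (u v : 'cV[R]_n) : dotv u (- v) = - dotv u v.
Proof. by rewrite !(dotvC u) dotvNl. Qed.

Lemma dotvBr n (u v w : 'cV[R]_n) : dotv u (v - w) = dotv u v - dotv u w.
Proof. by rewrite dotvDr dotvNr. Qed.

Lemma dotv0l n (u : 'cV[R]_n) : dotv 0 u = 0.
Proof. by rewrite -(scale0r 0) dotvZl mul0r. Qed.

Lemma dotv0r n (u : 'cV[R]_n) : dotv u 0 = 0.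
Proof. by rewrite dotvC dotv0l. Qed.

Lemma dotv_mulmxr m n (A : 'M[R]_(m, n)) u v :
  dotv u (A *m v) = dotv (A^T *m u) v.
Proof.
rewrite /dotv; under eq_bigr do rewrite mxE mulr_sumr.
rewrite exchange_big; apply: eq_bigr => j _; rewrite mxE mulr_suml.
by apply: eq_bigr => i _; rewrite mxE mulrCA mulrA.
Qed.

Lemma dotv_sumr n (I : Type) (r : seq I) (u : 'cV[R]_n) (F : I -> 'cV[R]_n) :
  dotv u (\sum_(i <- r) F i) = \sum_(i <- r) dotv u (F i).
Proof. exact: (big_morph _ (dotvDr u) (dotv0r u)). Qed.

Lemma trmx_mul_dotv n (u v : 'cV[R]_n) : u^T *m v = (dotv u v)%:M.
Proof.
apply/matrixP => i j; rewrite !ord1 !mxE mulr1n.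
by apply: eq_bigr => k _; rewrite mxE.
Qed.

Lemma dotv_outer n (u v : 'cV[R]_n) : dotv v ((u *m u^T) *m v) = dotv u v ^+ 2.
Proof.
by rewrite -mulmxA trmx_mul_dotv mul_mx_scalar dotvZr (dotvC v) expr2.
Qed.

Lemma mxtrace_outer n (u : 'cV[R]_n) (G : 'M[R]_n) :
  \tr ((u *m u^T) *m G) = dotv u (G *m u).
Proof.
rewrite -mulmxA mxtrace_mulC -mulmxA trmx_mul_dotv.
by rewrite /mxtrace big_ord1 mxE mulr1n.
Qed.

Lemma dotvv_ge0 n (u : 'cV[R]_n) : 0 <= dotv u u.
Proof. by apply: sumr_ge0 => i _; rewrite -expr2 sqr_ge0. Qed.

Lemma dotvv_eq0 n (u : 'cV[R]_n) : dotv u u = 0 -> u = 0.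
Proof.
move=> /eqP; rewrite psumr_eq0; last by move=> i _; rewrite -expr2 sqr_ge0.
move=> /allP u0; apply/colP => i; rewrite mxE; apply/eqP.
by have := u0 i (mem_index_enum i); rewrite mulf_eq0 orbb.
Qed.

Lemma l2normE n (u : 'cV[R]_n) : l2norm u = Num.sqrt (dotv u u).
Proof. by congr Num.sqrt; apply: eq_bigr => i _; rewrite expr2. Qed.

Lemma l2norm_ge0 n (u : 'cV[R]_n) : 0 <= l2norm u.
Proof. exact: sqrtr_ge0. Qed.

Lemma sqr_l2norm n (u : 'cV[R]_n) : l2norm u ^+ 2 = dotv u u.
Proof. by rewrite l2normE sqr_sqrtr ?dotvv_ge0. Qed.

Lemma l2norm_eq0 n (u : 'cV[R]_n) : l2norm u = 0 -> u = 0.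
Proof. by move=> u0; apply: dotvv_eq0; rewrite -sqr_l2norm u0 expr0n. Qed.

Lemma l2normZ n (k : R) (u : 'cV[R]_n) : l2norm (k *: u) = `|k| * l2norm u.
Proof.
by rewrite !l2normE dotvZl dotvZr mulrA -expr2 sqrtrM ?sqr_ge0 // sqrtr_sqr.
Qed.

Lemma l2normN n (u : 'cV[R]_n) : l2norm (- u) = l2norm u.
Proof. by rewrite -scaleN1r l2normZ normrN1 mul1r. Qed.

Lemma l2norm0 n : l2norm (0 : 'cV[R]_n) = 0.
Proof. by rewrite l2normE dotv0l sqrtr0. Qed.

Lemma CauchySchwarz_dotv n (u v : 'cV[R]_n) :
  `|dotv u v| <= l2norm u * l2norm v.
Proof.
rewrite -(@ler_pXn2r _ 2) ?nnegrE ?mulr_ge0 ?l2norm_ge0 //.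
rewrite exprMn !sqr_l2norm real_normK ?num_real //.
have [v0|v_neq0] := eqVneq (dotv v v) 0.
  by rewrite (dotvv_eq0 v0) dotv0l dotv0r mulr0 expr0n.
have v_gt0 : 0 < dotv v v by rewrite lt_def v_neq0 dotvv_ge0.
(* The squared norm of this vector is [dotv v v] times the difference
   [dotv u u * dotv v v - dotv u v ^+ 2], which is therefore nonnegative. *)
have := dotvv_ge0 (dotv v v *: u - dotv u v *: v).
rewrite dotvBl !dotvBr !dotvZl !dotvZr (dotvC v u) => h.
by rewrite -subr_ge0 -(pmulr_rge0 _ v_gt0); apply: le_trans h _; nra.
Qed.

Lemma ler_l2normD n (u v : 'cV[R]_n) : l2norm (u + v) <= l2norm u + l2norm v.
Proof.
rewrite -(@ler_pXn2r _ 2) ?nnegrE ?addr_ge0 ?l2norm_ge0 //.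
rewrite sqrrD !sqr_l2norm dotvDl !dotvDr (dotvC v u).
have := le_trans (ler_norm _) (CauchySchwarz_dotv u v); lra.
Qed.

(** The source of the factor $\sqrt{m-1}$: it converts entrywise bounds on [L *m gradient E y] into
    a Euclidean bound. *)
Lemma ler_l2norm_sqrt n (u : 'cV[R]_n) (B : R) :
  (forall i, `|u i 0| <= B) -> l2norm u <= Num.sqrt n%:R * B.
Proof.
(* In dimension 0 the hypothesis does not make [B] nonnegative, but both sides are 0. *)
move=> uB; case: n u uB => [|n] u uB.
  by rewrite /l2norm big_ord0 !sqrtr0 mul0r.
have B0 : 0 <= B := le_trans (normr_ge0 _) (uB ord0).
have -> : Num.sqrt n.+1%:R * B = Num.sqrt (n.+1%:R * B ^+ 2).
  by rewrite sqrtrM ?ler0n // sqrtr_sqr ger0_norm.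
rewrite ler_wsqrtr //.
apply: le_trans (_ : \sum_(i < n.+1) B ^+ 2 <= _); last first.
  by rewrite sumr_const card_ord mulr_natl.
apply: ler_sum => i _; rewrite -real_normK ?num_real //.
by rewrite lerXn2r ?nnegrE.
Qed.

Lemma sqr_frobenius_norm m n (A : 'M[R]_(m, n)) :
  frobenius_norm A ^+ 2 = \sum_i \sum_j A i j ^+ 2.
Proof.
rewrite sqr_sqrtr //.
by apply: sumr_ge0 => i _; apply: sumr_ge0 => j _; rewrite sqr_ge0.
Qed.

Lemma sqr_frobenius_normE p q (A : 'M[R]_(p, q)) :
  frobenius_norm A ^+ 2 = \tr (A^T *m A).
Proof.
rewrite sqr_frobenius_norm /mxtrace exchange_big; apply: eq_bigr => j _.
by rewrite mxE; apply: eq_bigr => i _; rewrite mxE expr2.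
Qed.

Lemma frobenius_norm_eq0 p q (A : 'M[R]_(p, q)) :
  frobenius_norm A ^+ 2 = 0 -> A = 0.
Proof.
rewrite sqr_frobenius_norm => A0; apply/matrixP => i j; rewrite mxE.
move: A0 => /psumr_eq0P/(_ i isT) Ai0.
have /Ai0 /psumr_eq0P/(_ j isT)/eqP : forall i, true -> 0 <= \sum_j A i j ^+ 2.
  by move=> k _; apply: sumr_ge0 => l _; exact: sqr_ge0.
by rewrite sqrf_eq0 => /(_ (fun k _ => sqr_ge0 _))/eqP.
Qed.

(** Cauchy-Schwarz applied row by row. This crude bound is what makes the supremum in
    [spectral_norm] finite and the set in [lipschitz_constant] nonempty. *)
Lemma l2norm_mulmx_frobenius m n (A : 'M[R]_(m, n)) v :
  l2norm (A *m v) <= frobenius_norm A * l2norm v.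
Proof.
rewrite -(@ler_pXn2r _ 2) ?nnegrE ?mulr_ge0 ?sqrtr_ge0 ?l2norm_ge0 //.
rewrite exprMn sqr_frobenius_norm [X in X <= _]sqr_l2norm mulr_suml.
apply: ler_sum => i _.
have -> : (A *m v) i 0 = dotv (row i A)^T v.
  by rewrite mxE; apply: eq_bigr => j _; rewrite !mxE.
have -> : \sum_j A i j ^+ 2 = l2norm (row i A)^T ^+ 2.
  by rewrite sqr_l2norm; apply: eq_bigr => j _; rewrite !mxE expr2.
rewrite -expr2 -exprMn -real_normK ?num_real //.
by rewrite lerXn2r ?nnegrE ?mulr_ge0 ?l2norm_ge0 ?CauchySchwarz_dotv.
Qed.

Lemma has_sup_spectral_norm m n (A : 'M[R]_(m, n)) :
  has_sup [set l2norm (A *m v) | v in [set v | l2norm v <= 1]].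
Proof.
split; first by exists (l2norm (A *m 0)), 0; rewrite //= l2norm0.
exists (frobenius_norm A) => _ [v /= v1 <-].
apply: le_trans (l2norm_mulmx_frobenius _ _) _.
by rewrite ler_piMr ?sqrtr_ge0.
Qed.

Lemma spectral_norm_ge0 m n (A : 'M[R]_(m, n)) : 0 <= spectral_norm A.
Proof.
apply: ub_le_sup; first by case: (has_sup_spectral_norm A).
by exists 0; rewrite /= ?mulmx0 l2norm0.
Qed.

Lemma l2norm_mulmx m n (A : 'M[R]_(m, n)) v :
  l2norm (A *m v) <= spectral_norm A * l2norm v.
Proof.
have [v0|v_neq0] := eqVneq (l2norm v) 0.
  by rewrite v0 (l2norm_eq0 v0) mulmx0 l2norm0 mulr0.
have v_gt0 : 0 < l2norm v by rewrite lt_def v_neq0 l2norm_ge0.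
(* Normalizing [v] brings it into the unit ball over which the supremum is taken. *)
have -> : l2norm (A *m v) = l2norm (A *m ((l2norm v)^-1 *: v)) * l2norm v.
  by rewrite -scalemxAr l2normZ gtr0_norm ?invr_gt0 // mulrC mulVKf.
rewrite ler_wpM2r ?l2norm_ge0 //.
apply: ub_le_sup; first by case: (has_sup_spectral_norm A).
by eexists; last reflexivity; rewrite /= l2normZ gtr0_norm ?invr_gt0 // mulVf.
Qed.

(** For a fixed nonzero [v], every admissible [L] is at least the quotient of [l2norm (A *m v)] by
    [l2norm v], hence so is the infimum. It is applied to the gradient of a quadratic, with [A] its
    Hessian. *)
Lemma lipschitz_constantP m n (g : 'cV[R]_n -> 'cV[R]_m) (A : 'M[R]_(m, n)) :
  (forall x y, g x - g y = A *m (x - y)) ->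
  0 <= lipschitz_constant g /\
  forall v, l2norm (A *m v) <= lipschitz_constant g * l2norm v.
Proof.
move=> gA; set S := [set L | 0 <= L /\
  forall x y, l2norm (g x - g y) <= L * l2norm (x - y)].
have S0 : S !=set0.
  exists (frobenius_norm A); split=> [|x y]; first exact: sqrtr_ge0.
  by rewrite gA l2norm_mulmx_frobenius.
split=> [|v]; first by apply: lb_le_inf => // L [].
have [v0|v_neq0] := eqVneq (l2norm v) 0.
  by rewrite v0 (l2norm_eq0 v0) mulmx0 l2norm0 mulr0.
have v_gt0 : 0 < l2norm v by rewrite lt_def v_neq0 l2norm_ge0.
rewrite -ler_pdivrMr //; apply: lb_le_inf => // L [_ /(_ v 0)].
by rewrite gA subr0 ler_pdivrMr.
Qed.

(** It suffices that [L^T *m L] is invertible. A row [v] in its left kernel satisfies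
    $\|Lv^\top\|^2=0$, and full column rank of [L] then forces [v] to vanish. *)
Lemma left_pinvK m n (L : 'M[R]_(m, n)) : \rank L = n ->
  left_pinv L *m L = 1%:M.
Proof.
move=> rkL; rewrite /left_pinv -mulmxA mulVmx // -row_free_unit.
apply: inj_row_free => v vLL.
have /dotvv_eq0 Lv0 : dotv (L *m v^T) (L *m v^T) = 0.
  rewrite dotv_mulmxr; suff -> : L^T *m (L *m v^T) = 0 by rewrite dotv0l.
  by apply: trmx_inj; rewrite !trmx_mul !trmxK -mulmxA vLL trmx0.
have : row_free L^T by rewrite /row_free mxrank_tr rkL.
move=> /row_freeP[B LB]; rewrite -[v]mulmx1 -LB mulmxA.
by rewrite -[v *m _]trmxK trmx_mul trmxK Lv0 trmx0 mul0mx.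
Qed.

End EuclideanNorm.

(** * Gradients, Hessians and exact Taylor expansions of quadratic functions *)

Section QuadraticFunctions.
Variables (R : realType) (n : nat).
Implicit Types (f g : 'cV[R]_n -> R) (x y z v : 'cV[R]_n).

Lemma dotv_mulmxE (H : 'M[R]_n) x v :
  dotv x (H *m v) = \sum_i \sum_j H i j * (x i 0 * v j 0).
Proof.
apply: eq_bigr => i _; rewrite mxE mulr_sumr.
by apply: eq_bigr => j _; rewrite mulrCA.
Qed.

Lemma quadraticP f : quadratic f <-> exists a b (H : 'M[R]_n),
  forall y, f y = a + dotv b y + dotv y (H *m y).
Proof.
by split=> -[a [b [H fE]]]; exists a, b, H => y; rewrite fE dotv_mulmxE.
Qed.

Lemma hessian_dotvE a b (H : 'M[R]_n) f x :
  (forall y, f y = a + dotv b y + dotv y (H *m y)) -> hessian f x = H + H^T.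
Proof.
by move=> fE; apply: (@hessian_quadraticE _ _ a b) => y; rewrite fE dotv_mulmxE.
Qed.

Lemma is_derive_dotvE a b (H : 'M[R]_n) f x v :
  (forall y, f y = a + dotv b y + dotv y (H *m y)) ->
  is_derive x v f (dotv (b + (H + H^T) *m x) v).
Proof.
move=> fE; have /is_derive_quadratic-/(_ x v) fd : forall y, f y =
    a + \sum_i b i 0 * y i 0 + \sum_i \sum_j H i j * (y i 0 * y j 0).
  by move=> y; rewrite fE dotv_mulmxE.
apply: is_derive_eq.
rewrite dotvDl mulmxDl dotvDl; congr (_ + _).
rewrite addrC [dotv (H *m x) v]dotvC -dotv_mulmxr !dotv_mulmxE -big_split /=.
apply: eq_bigr => i _; rewrite -big_split; apply: eq_bigr => j _ /=.
by rewrite mulrDr; congr (_ + H i j * _); rewrite mulrC.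
Qed.

Lemma dotv_delta v i : dotv v (delta_mx i 0) = v i 0.
Proof.
rewrite /dotv (bigD1 i) //= big1 ?addr0 ?mxE ?eqxx ?mulr1 // => j ji.
by rewrite mxE (negbTE ji) mulr0.
Qed.

Lemma gradient_dotvE a b (H : 'M[R]_n) f x :
  (forall y, f y = a + dotv b y + dotv y (H *m y)) ->
  gradient f x = b + (H + H^T) *m x.
Proof.
move=> fE; apply/colP => i; rewrite mxE.
by have [_ ->] := is_derive_dotvE x (delta_mx i 0) fE; rewrite dotv_delta.
Qed.

Lemma derivable_quadratic f x v : quadratic f -> derivable f x v.
Proof. by move=> /quadraticP[a [b [H /is_derive_dotvE-/(_ x v)[]]]]. Qed.

Lemma gradient_quadraticB f x y : quadratic f ->
  gradient f x - gradient f y = hessian f 0 *m (x - y).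
Proof.
move=> /quadraticP[a [b [H fE]]].
rewrite !(gradient_dotvE _ fE) (hessian_dotvE _ fE) mulmxBr.
by rewrite opprD addrACA subrr add0r.
Qed.

(** The expansion is exact since the degree is at most 2. As [H] need not be symmetric, the proof
    moves transposes across [dotv] before comparing terms. *)
Lemma quadratic_taylor f z y : quadratic f ->
  f y = f z + dotv (gradient f z) (y - z)
      + 2^-1 * dotv (y - z) (hessian f 0 *m (y - z)).
Proof.
move=> /quadraticP[a [b [H fE]]].
rewrite (gradient_dotvE _ fE) (hessian_dotvE _ fE) !fE.
have -> : y = (y - z) + z by rewrite subrK.
move: (y - z) => w; rewrite addrK !mulmxDl !mulmxDr !dotvDl !dotvDr.
rewrite [dotv w (H^T *m w)]dotv_mulmxr trmxK [dotv (H *m w) w]dotvC.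
rewrite [dotv (H^T *m z) w]dotvC [dotv w (H^T *m z)]dotv_mulmxr trmxK.
rewrite [dotv (H *m w) z]dotvC [dotv (H *m z) w]dotvC; lra.
Qed.

(** Allows a quadratic to be specified around a base point, as the KKT system does around [x0]. *)
Lemma quadratic_shift a b (H : 'M[R]_n) z f :
  (forall y, f y = a + dotv b (y - z) + dotv (y - z) (H *m (y - z))) ->
  quadratic f /\ hessian f 0 = H + H^T.
Proof.
move=> fE; have fE0 y : f y = (a - dotv b z + dotv z (H *m z))
    + dotv (b - (H + H^T) *m z) y + dotv y (H *m y).
  rewrite fE mulmxBr mulmxDl !dotvBl !dotvBr !dotvDl.
  rewrite [dotv (H *m z) y]dotvC [dotv (H^T *m z) y]dotvC.
  rewrite [dotv y (H^T *m z)]dotv_mulmxr trmxK [dotv (H *m y) z]dotvC; lra.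
split; last exact: hessian_dotvE fE0.
by apply/quadraticP; do 3!eexists; exact: fE0.
Qed.

Lemma quadratic_cst (a : R) :
  quadratic (cst a : 'cV[R]_n -> R) /\ hessian (cst a : 'cV[R]_n -> R) 0 = 0.
Proof.
have cE y : (cst a : 'cV[R]_n -> R) y
    = a + dotv 0 (y - 0) + dotv (y - 0) (0 *m (y - 0)).
  by rewrite dotv0l mul0mx dotv0r !addr0.
by have := quadratic_shift cE; rewrite trmx0 addr0.
Qed.

Lemma quadratic_lin k f g : quadratic f -> quadratic g ->
  quadratic (fun y => k * f y + g y) /\
  hessian (fun y => k * f y + g y) 0 = k *: hessian f 0 + hessian g 0.
Proof.
move=> /quadraticP[a [b [H fE]]] /quadraticP[a' [b' [H' gE]]].
have E y : k * f y + g y = k * a + a'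
    + dotv (k *: b + b') y + dotv y ((k *: H + H') *m y).
  by rewrite fE gE mulmxDl -scalemxAl dotvDl dotvDr dotvZl dotvZr; lra.
split; first by apply/quadraticP; do 3!eexists; exact: E.
rewrite (hessian_dotvE _ E) (hessian_dotvE _ fE) (hessian_dotvE _ gE).
by rewrite linearP scalerDr addrACA.
Qed.

Lemma quadraticB f g : quadratic f -> quadratic g ->
  quadratic (fun y => f y - g y) /\
  hessian (fun y => f y - g y) 0 = hessian f 0 - hessian g 0.
Proof.
move=> qf qg; have := quadratic_lin (-1) qg qf.
rewrite (_ : (fun y => _) = fun y => f y - g y); last first.
  by apply/funext => y; rewrite mulN1r addrC.
by rewrite scaleN1r addrC.
Qed.

Lemma gradient_lin k f g x :
  (forall v, derivable f x v) -> (forall v, derivable g x v) ->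
  gradient (fun y => k * f y + g y) x = k *: gradient f x + gradient g x.
Proof.
move=> df dg; apply/colP => i; rewrite !mxE.
by rewrite (@deriveD _ _ _ (k \*: f) g) ?deriveZ //; exact: derivableZ.
Qed.

End QuadraticFunctions.

(** * First-order optimality for the least-change problem *)

Section LeastChange.
Variables (R : realType) (n m : nat).
Variables (x : 'I_m -> 'cV[R]_n) (x0 : 'cV[R]_n).
Implicit Types (Qa h P Q : 'cV[R]_n -> R).

(* First-order optimality condition of the least-change problem. *)
Definition stationary Qa h Q := [/\ quadratic Q, interpolates x h Q &
  forall P, quadratic P -> interpolates x (cst 0) P ->
    \tr ((hessian Q 0 - hessian Qa 0)^T *m hessian P 0) = 0].

(** Pythagoras for the Frobenius product: [P - Q] is a quadratic vanishing on the interpolation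
    points, so stationarity kills the cross terms. *)
Lemma stationary_change Qa h Q P :
  stationary Qa h Q -> quadratic P -> interpolates x h P ->
  hessian_change Qa P =
    hessian_change Qa Q + frobenius_norm (hessian P 0 - hessian Q 0) ^+ 2.
Proof.
move=> [qQ iQ orthQ] qP iP; have [qD hD] := quadraticB qP qQ.
have /(_ _ qD) := orthQ; rewrite hD => orthD.
have {}orthD : \tr ((hessian Q 0 - hessian Qa 0)^T
    *m (hessian P 0 - hessian Q 0)) = 0.
  by apply: orthD => i; rewrite iQ iP subrr.
rewrite /hessian_change; move: orthD.
move: (hessian P 0) (hessian Q 0) (hessian Qa 0) => HP HQ Ha.
rewrite -[HP - Ha](subrKA HQ); move: (HQ - Ha) (HP - HQ) => A B AB0.
rewrite !sqr_frobenius_normE [(B + A)^T]linearD /= mulmxDl !mulmxDr.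
rewrite !mxtraceD AB0.
(* The second cross term is the trace of the transpose of the first. *)
by rewrite -(mxtrace_tr (B^T *m A)) trmx_mul trmxK AB0 addr0 add0r addrC.
Qed.

Lemma stationary_solution Qa h Q :
  stationary Qa h Q -> least_change_solution x Qa h Q.
Proof.
move=> sQ; case: (sQ) => qQ iQ _.
split; [exact: qQ | exact: iQ | move=> P qP iP].
by rewrite (stationary_change sQ qP iP) lerDl sqr_ge0.
Qed.

(** * Uniqueness and existence of the least-change interpolant of a poised set *)

Hypothesis poised_x : poised x x0.

(** The value and gradient of [P] at [x0] form a vector [g] killed by the transpose of [kkt_X].
    Hence [col_mx 0 g] lies in the kernel of the invertible KKT matrix. *)
Lemma poised_affine_eq0 P : quadratic P -> hessian P 0 = 0 ->
  interpolates x (cst 0) P -> P = cst 0.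
Proof.
move=> qP hP iP.
have PE y : P y = P x0 + dotv (gradient P x0) (y - x0).
  by rewrite (quadratic_taylor x0 y qP) hP mul0mx dotv0r mulr0 addr0.
pose g : 'cV[R]_(1 + n) := col_mx (P x0)%:M (gradient P x0).
have Xg : (kkt_X x x0)^T *m g = 0.
  apply/colP => i; rewrite tr_col_mx mul_row_col mxE.
  rewrite mul_mx_scalar !mxE mulr1; transitivity (P (x i)); last exact: iP.
  rewrite [RHS]PE; congr (_ + _); rewrite dotvC.
  by apply: eq_bigr => k _; rewrite !mxE.
have : kkt_matrix x x0 *m col_mx 0 g = 0.
  by rewrite mul_block_col !mulmx0 Xg mul0mx !addr0 col_mx0.
move=> /(congr1 (mulmx (invmx (kkt_matrix x x0)))).
rewrite mulKmx // mulmx0 -[RHS]col_mx0 => /eq_col_mx[_].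
rewrite -[RHS]col_mx0 => /eq_col_mx[/colP/(_ 0) P0 gP0].
apply/funext => y; rewrite PE gP0 dotv0l addr0.
by move: P0; rewrite !mxE mulr1n.
Qed.

Lemma stationary_unique Qa h Q Q' :
  stationary Qa h Q -> least_change_solution x Qa h Q' -> Q' = Q.
Proof.
move=> sQ [qQ' iQ' minQ']; have [qQ iQ _] := sQ.
have [qD hD] := quadraticB qQ' qQ.
have hD0 : hessian Q' 0 - hessian Q 0 = 0.
  apply: frobenius_norm_eq0; apply/le_anti; rewrite sqr_ge0 andbT.
  (* Minimality of [Q'] against the competitor [Q] leaves no room for the extra square in the
     Pythagorean identity. *)
  by have := minQ' _ qQ iQ; rewrite (stationary_change sQ qQ' iQ') gerDl.
have D0 : (fun y => Q' y - Q y) = cst 0.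
  apply: poised_affine_eq0; rewrite ?hD //.
  by move=> i; rewrite iQ iQ' subrr.
by apply/funext => y; apply/eqP; rewrite -subr_eq0 (congr1 (@^~ y) D0).
Qed.

Lemma least_change_model_unique Qa h Q :
  stationary Qa h Q -> least_change_model x Qa h = Q.
Proof.
move=> sQ; apply: xget_unique; first exact: stationary_solution.
by move=> Q'; exact: stationary_unique.
Qed.

(** Solve the KKT system with the residuals [d] on top and 0 below. In the solution, [l] holds the
    Lagrange multipliers, while [g0] and [g] are the value and gradient at [x0] of the correction
    [D] to be added to [Qa]. The lower rows say that the multipliers annihilate affine functions at
    the interpolation points. *)
Lemma exists_stationary Qa h : quadratic Qa -> exists Q, stationary Qa h Q.
Proof.
move=> qQa; pose d : 'cV[R]_m := \col_i (h (x i) - Qa (x i)).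
pose s : 'cV[R]_(m + (1 + n)) := invmx (kkt_matrix x x0) *m col_mx d 0.
have : kkt_matrix x x0 *m s = col_mx d 0 by rewrite mulKVmx.
rewrite -[s]vsubmxK -[dsubmx s]vsubmxK.
move: (usubmx s) (usubmx (dsubmx s)) (dsubmx (dsubmx s)) => l g0 g.
rewrite mul_block_col mul0mx addr0 => /eq_col_mx[interp].
rewrite mul_col_mx -[RHS]col_mx0 => /eq_col_mx[sum_l sum_lx].
have {}sum_l : \sum_j l j 0 = 0.
  move/colP/(_ 0): sum_l; rewrite !mxE => {2}<-.
  by apply: eq_bigr => j _; rewrite mxE mul1r.
have {}sum_lx : \sum_j l j 0 *: (x j - x0) = 0.
  apply/colP => k; move/colP/(_ k): sum_lx; rewrite !mxE summxE => {2}<-.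
  by apply: eq_bigr => j _; rewrite !mxE mulrC.
(* The factor 1/2 matches the one in [kkt_A]; the Hessian of [D] is [S + S^T], that is $\sum_j
   l_j(x_j-x_0)(x_j-x_0)^\top$. *)
pose S := \sum_j (2^-1 * l j 0) *: ((x j - x0) *m (x j - x0)^T).
have ST : S^T = S.
  rewrite linear_sum; apply: eq_bigr => j _.
  by rewrite linearZ /= trmx_mul trmxK.
have SE v : dotv v (S *m v) = \sum_j 2^-1 * l j 0 * dotv (x j - x0) v ^+ 2.
  rewrite mulmx_suml dotv_sumr; apply: eq_bigr => j _.
  by rewrite -scalemxAl dotvZr dotv_outer.
pose D y := g0 0 0 + dotv g (y - x0) + dotv (y - x0) (S *m (y - x0)).
have [qD hD] := quadratic_shift (fun y => erefl (D y)).
have iD i : D (x i) = d i 0.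
  rewrite -interp tr_col_mx mul_row_col addrC mxE /D SE; congr (_ + _).
    rewrite !mxE big_ord1 !mxE mul1r dotvC; congr (_ + _).
    by apply: eq_bigr => k _; rewrite !mxE.
  by rewrite mxE; apply: eq_bigr => j _; rewrite !mxE dotvC mulrAC.
have [qQ hQ] := quadratic_lin 1 qQa qD.
exists (fun y => 1 * Qa y + D y); split=> // [i|P qP iP].
  by rewrite mul1r iD mxE addrC subrK.
rewrite hQ scale1r addrAC subrr add0r hD ST linearD /= ST mulmxDl mxtraceD.
suff -> : \tr (S *m hessian P 0) = 0 by rewrite addr0.
(* Since [P] vanishes at [x j], its Taylor expansion at [x0] trades the quadratic term for an affine
   one, and the weighted sum of those is 0. *)
have trE j : \tr ((2^-1 * l j 0) *: ((x j - x0) *m (x j - x0)^T) *m hessian P 0)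
    = - P x0 * l j 0 - dotv (gradient P x0) (l j 0 *: (x j - x0)).
  rewrite -scalemxAl mxtraceZ mxtrace_outer dotvZr.
  by have := quadratic_taylor x0 (x j) qP; rewrite iP /=; nra.
rewrite mulmx_suml linear_sum /=; under eq_bigr do rewrite trE.
by rewrite sumrB -mulr_sumr sum_l mulr0 -dotv_sumr sum_lx dotv0r subrr.
Qed.

Lemma least_change_modelP Qa h :
  quadratic Qa -> stationary Qa h (least_change_model x Qa h).
Proof.
move=> /exists_stationary-/(_ h)[Q sQ].
by rewrite (least_change_model_unique sQ).
Qed.

End LeastChange.

(** * The model of an affinely rescaled objective *)

Section ScaledModel.
Variables (R : realType) (n m : nat) (x : 'I_m -> 'cV[R]_n).
Implicit Types (Qa Qb Qt E f : 'cV[R]_n -> R).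

(** The term with factor [1 - C1] does not disturb interpolation because [Qa] and [Qt] agree on the
    points; its role is to restore orthogonality of the Hessian change. *)
Lemma stationary_scale Qa Qb Qt f (C1 C2 : R) : quadratic Qa ->
  stationary x Qa f Qb -> stationary x (cst 0) Qa Qt ->
  stationary x Qa (fun y => C1 * f y + C2)
    (fun y => C1 * Qb y + ((1 - C1) * (Qa y - Qt y) + C2)).
Proof.
move=> qQa [qQb iQb orthb] [qQt iQt ortht].
have [qE hE] := quadraticB qQa qQt.
have [qC hC] := quadratic_cst n C2.
have [q1 h1] := quadratic_lin (1 - C1) qE qC.
have [q2 h2] := quadratic_lin C1 qQb q1.
split; first exact: q2.
  by move=> i; rewrite iQb iQt subrr mulr0 add0r.
move=> P qP iP; rewrite h2 h1 hC hE.
have := ortht P qP iP; rewrite (quadratic_cst n (0 : R)).2 subr0.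
have := orthb P qP iP.
move: (hessian Qb 0) (hessian Qa 0) (hessian Qt 0) => B A T BP TP.
(* Both summands are orthogonal to the Hessian of [P]: [B - A] by stationarity of [Qb], and [T] by
   that of [Qt], whose reference Hessian is 0. *)
have -> : C1 *: B + ((1 - C1) *: (A - T) + 0) - A
    = C1 *: (B - A) + (C1 - 1) *: T.
  rewrite addr0 -[1 - C1]opprB scaleNr !scalerBr opprB !scalerBl !scale1r.
  by apply/matrixP => i j; rewrite !mxE; ring.
rewrite linearD /= mulmxDl mxtraceD !linearZ /= -!scalemxAl !mxtraceZ BP TP.
by rewrite !mulr0 addr0.
Qed.

(** * Bounds for a quadratic that vanishes on the interpolation points *)

Variables (c : 'I_m) (Delta : R).
Hypothesis Delta_gt0 : 0 < Delta.
Hypothesis x_ball : forall i, l2ball (x c) Delta (x i).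
Hypothesis rank_x : \rank (scaled_displacements x c Delta) = n.

Lemma quadratic_form_bound (H : 'M[R]_n) nu r v : 0 <= nu ->
  (forall v, l2norm (H *m v) <= nu * l2norm v) -> l2norm v <= r ->
  `|dotv v (H *m v)| <= nu * r ^+ 2.
Proof.
move=> nu0 Hnu vr; apply: le_trans (CauchySchwarz_dotv _ _) _.
apply: le_trans (ler_wpM2l (l2norm_ge0 v) (Hnu v)) _.
rewrite mulrCA ler_wpM2l // -expr2 lerXn2r ?nnegrE ?l2norm_ge0 //.
exact: le_trans (l2norm_ge0 v) vr.
Qed.

Variables (E : 'cV[R]_n -> R) (nu : R).
Hypothesis quadE : quadratic E.
Hypothesis E0 : forall i, E (x i) = 0.
Hypothesis nu_ge0 : 0 <= nu.
Hypothesis hessE : forall v, l2norm (hessian E 0 *m v) <= nu * l2norm v.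

(** Here 5/2 is $(2^2+1^2)/2$, from two second-order Taylor remainders at distances at most
    $2\Delta$ and $\Delta$; $m-1$ is the number of rows of the displacement matrix. *)
Let lam := 5 * Num.sqrt ((m - 1)%:R) / 2 *
  spectral_norm (left_pinv (scaled_displacements x c Delta)).

(* Subtract the Taylor expansions at y of E (x i) = 0 and E (x c) = 0; the two
   quadratic remainders are controlled by |x i - y| <= 2 Delta and
   |x c - y| <= Delta. *)
Lemma directional_gradient_bound y i : l2ball (x c) Delta y ->
  `|dotv (gradient E y) (x i - x c)| <= 5 / 2 * nu * Delta ^+ 2.
Proof.
move=> yB.
have cy : l2norm (x c - y) <= Delta by rewrite -l2normN opprB.
have iy : l2norm (x i - y) <= 2 * Delta.
  rewrite -(subrKA (x c)); apply: le_trans (ler_l2normD _ _) _.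
  by have := x_ball i; rewrite /l2ball /=; lra.
have -> : x i - x c = (x i - y) - (x c - y) by rewrite opprB addrA subrK.
rewrite dotvBr.
have := quadratic_taylor y (x i) quadE; have := quadratic_taylor y (x c) quadE.
have := quadratic_form_bound nu_ge0 hessE cy.
have := quadratic_form_bound nu_ge0 hessE iy.
rewrite !E0 exprMn !ler_norml => /andP[? ?] /andP[? ?] Ec Ei.
by apply/andP; split; lra.
Qed.

Lemma gradient_bound y : l2ball (x c) Delta y ->
  l2norm (gradient E y) <= lam * nu * Delta.
Proof.
move=> yB; pose L := scaled_displacements x c Delta.
have -> : gradient E y = left_pinv L *m (L *m gradient E y).
  by rewrite mulmxA left_pinvK // mul1mx.
apply: le_trans (l2norm_mulmx _ _) _.
have : l2norm (L *m gradient E y) <= Num.sqrt m.-1%:R * (5 / 2 * nu * Delta).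
  apply: ler_l2norm_sqrt => i.
  (* Each row of [L] carries a factor $1/\Delta$, which lowers the bound on directional derivatives
     from order $\Delta^2$ to order $\Delta$. *)
  have -> : (L *m gradient E y) i 0
      = Delta^-1 * dotv (gradient E y) (x (lift c i) - x c).
    rewrite mxE /dotv mulr_sumr; apply: eq_bigr => k _.
    by rewrite !mxE mulrAC mulrA.
  rewrite normrM gtr0_norm ?invr_gt0 // ler_pdivrMl //.
  apply: le_trans (directional_gradient_bound _ yB) _.
  by rewrite expr2 mulrA mulrC.
move=> /(ler_wpM2l (spectral_norm_ge0 (left_pinv L)))/le_trans; apply.
by rewrite /lam -/L subn1; lra.
Qed.

(** Expand at [y] and evaluate at [x c], where [E] vanishes: the gradient term contributes [lam] and
    the quadratic remainder contributes 1/2. *)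
Lemma value_bound y : l2ball (x c) Delta y ->
  `|E y| <= (lam + 2^-1) * nu * Delta ^+ 2.
Proof.
move=> yB; have cy : l2norm (x c - y) <= Delta by rewrite -l2normN opprB.
have := quadratic_form_bound nu_ge0 hessE cy.
have : `|dotv (gradient E y) (x c - y)| <= lam * nu * Delta * Delta.
  apply: le_trans (CauchySchwarz_dotv _ _) _.
  by apply: ler_pM; rewrite ?l2norm_ge0 ?gradient_bound.
have := quadratic_taylor y (x c) quadE; rewrite E0.
rewrite !ler_norml => Ec /andP[? ?] /andP[? ?]; apply/andP; split; lra.
Qed.

End ScaledModel.

Theorem theorem8 (R : realType) (n m : nat) (x : 'I_m -> 'cV[R]_n)
    (x0 : 'cV[R]_n) (c : 'I_m) (Delta : R)
    (Qalpha f : 'cV[R]_n -> R) (kg kf C1 C2 : R) :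
  (n + 1 <= m)%N -> (2 * m < (n + 1) * (n + 2))%N ->
  injective x ->
  poised x x0 ->
  0 < Delta ->
  (forall i, l2ball (x c) Delta (x i)) ->
  \rank (scaled_displacements x c Delta) = n ->
  quadratic Qalpha ->
  (forall y, differentiable f y) ->
  fully_linear (x c) Delta f (least_change_model x Qalpha f) kg kf ->
  let g := fun y => C1 * f y + C2 in
  let Qtilde := least_change_model x (cst 0) Qalpha in
  let mu := lipschitz_constant (gradient Qalpha) in
  let Lpinv := left_pinv (scaled_displacements x c Delta) in
  let lam := 5 * Num.sqrt ((m - 1)%:R) / 2 * spectral_norm Lpinv in
  let nu := mu + spectral_norm (hessian Qtilde 0) in
  fully_linear (x c) Delta g (least_change_model x Qalpha g)
    (`|C1| * kg + `|C1 - 1| * (lam * nu))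
    (`|C1| * kf + `|C1 - 1| * ((lam + 2^-1) * nu)).
Proof.
move=> _ _ _ poised_x Delta_gt0 x_ball rank_x qQa df fl g Qt mu Lpinv lam nu.
have sb := least_change_modelP poised_x f qQa.
have st : stationary x (cst 0) Qalpha Qt.
  exact: (least_change_modelP poised_x Qalpha (quadratic_cst n (0 : R)).1).
(* Uniqueness replaces the model of [g] by the explicit candidate, so that only its two error terms
   remain to be estimated. *)
rewrite (least_change_model_unique poised_x (stationary_scale C1 C2 qQa sb st)).
move: fl sb; move: (least_change_model x Qalpha f) => Qb fl [qQb _ _].
have [qQt iQt _] := st.
have [qE hE] := quadraticB qQa qQt.
have [mu_ge0 muP] :=
  lipschitz_constantP (fun y z => gradient_quadraticB y z qQa).
have nu_ge0 : 0 <= nu by rewrite addr_ge0 ?spectral_norm_ge0.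
pose E y := Qalpha y - Qt y.
(* The Hessian of [E] is a difference; the first part is controlled by the Lipschitz constant [mu],
   the second by the spectral norm. *)
have hessE v : l2norm (hessian E 0 *m v) <= nu * l2norm v.
  rewrite hE mulmxBl mulrDl; apply: le_trans (ler_l2normD _ _) _.
  by rewrite l2normN; apply: lerD; [exact: muP | exact: l2norm_mulmx].
have E0 i : E (x i) = 0 by rewrite /E iQt subrr.
have [qC _] := quadratic_cst n C2.
have dC (y v : 'cV[R]_n) : derivable (cst C2 : 'cV[R]_n -> R) y v.
  exact: derivable_cst.
have gradC (y : 'cV[R]_n) : gradient (cst C2 : 'cV[R]_n -> R) y = 0.
  by apply/colP => i; rewrite !mxE derive_cst.
have gradQ y : gradient (fun y => C1 * Qb y + ((1 - C1) * E y + C2)) y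
    = C1 *: gradient Qb y + (1 - C1) *: gradient E y.
  rewrite gradient_lin; last 2 first.
  - by move=> v; exact: derivable_quadratic.
  - move=> v; apply: derivable_quadratic.
    exact: (quadratic_lin (1 - C1) qE qC).1.
  congr (_ + _); rewrite (@gradient_lin _ _ _ E (cst C2)) ?gradC ?addr0 //.
  by move=> v; exact: derivable_quadratic.
have gradg y : gradient g y = C1 *: gradient f y.
  rewrite (@gradient_lin _ _ _ f (cst C2)) ?gradC ?addr0 // => v.
  exact: diff_derivable.
move=> y yB; have [gb vb] := fl y yB; split.
  rewrite gradQ gradg addrAC -scalerBr.
  apply: le_trans (ler_l2normD _ _) _; rewrite !l2normZ [`|1 - C1|]distrC.
  rewrite mulrDl; apply: lerD; rewrite -mulrA ler_wpM2l //.
  exact: (gradient_bound Delta_gt0 x_ball rank_x qE E0 nu_ge0 hessE yB).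
(* The constant [C2] cancels, leaving the scaled error of [Qb] plus the perturbation by [E]. *)
have -> : C1 * Qb y + ((1 - C1) * E y + C2) - g y
  = C1 * (Qb y - f y) + (1 - C1) * E y by rewrite /g; ring.
apply: le_trans (ler_normD _ _) _; rewrite !normrM [`|1 - C1|]distrC.
rewrite mulrDl; apply: lerD; rewrite -mulrA ler_wpM2l //.
exact: (value_bound Delta_gt0 x_ball rank_x qE E0 nu_ge0 hessE yB).
Qed.
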